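(* A topological space $X$ has a domain representation via an $\omega$-algebraic dcpo if and only if $X$ is second countable, $T_1$, and has the strong Choquet property.
   Context: A nonempty subset $I$ of a poset is directed if every pair of elements of $I$ has an upper bound in $I$. A dcpo is a poset $D$ (with order $\preceq$) in which every directed subset has a least upper bound. For $p,q\in D$, $q\ll p$ ($q$ is way below $p$) means: whenever $I\subseteq D$ is directed and $p\preceq\sup I$, there is $r\in I$ with $q\preceq r$. Write ${\Downarrow}p=\{q\in D: q\ll p\}$ and ${\Uparrow}q=\{p\in D : q\ll p\}$. A dcpo is continuous if for every $p\in D$ the set ${\Downarrow}p$ is directed and $p=\sup{\Downarrow}p$; a domain is a continuous dcpo. A subset $B\subseteq D$ is a basis of $D$ if for every $p\in D$ the set $B\cap{\Downarrow}p$ is directed and $p=\sup(B\cap{\Downarrow}p)$. An element $p$ is compact if $p\ll p$. A dcpo is $\omega$-algebraic if it has a countable basis consisting of compact elements (such a dcpo is a domain). The Scott topology on a domain $D$ is the topology generated by the basis $\{{\Uparrow}p : p\in D\}$. A domain representation of $X$ via $D$ is a homeomorphism between $X$ and the set of maximal elements of the domain $D$ with the subspace topology of the Scott topology. The strong Choquet game on a topological space $X$ is played by players I and II in stages $i=0,1,2,\ldots$. At stage $i$, player I plays an open set $U_i$ and a point $x_i\in U_i$, with $U_i\subseteq V_{i-1}$ if $i>0$; then player II plays an open set $V_i$ with $x_i\in V_i\subseteq U_i$. Player II wins if $\bigcap_i U_i\neq\varnothing$ (equivalently $\bigcap_i V_i\ne\varnothing$); otherwise player I wins. $X$ has the strong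 Choquet property if player II has a winning strategy, i.e. a function assigning to each finite position in which player II is to move a legal move of player II, such that player II wins every infinite play in which player II's moves are given by this function. *)

(* Defs.v *)
From HB Require Import structures.
From mathcomp Require Import all_boot all_order finmap.
From mathcomp Require Import all_classical.
From mathcomp Require Import topology.

Set Implicit Arguments.
Unset Strict Implicit.
Unset Printing Implicit Defensive.

Import Order.TTheory.

Local Open Scope order_scope.
Local Open Scope classical_set_scope.

Section domain_theory.
Context {d : Order.disp_t} {D : porderType d}.
Implicit Types (p q r : D) (I B : set D).

Definition directed_set I :=
  I !=set0 /\ forall p q, I p -> I q -> exists r, [/\ I r, p <= r & q <= r].

Definition way_below q p :=
  forall I s, directed_set I -> isLub I s -> p <= s -> exists2 r, I r & q <= r.

Definition way_down p : set D := [set q | way_below q p].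

Definition way_up q : set D := [set p | way_below q p].

Definition domain_basis B :=
  forall p, directed_set (B `&` way_down p) /\ isLub (B `&` way_down p) p.

Definition compact_element p := way_below p p.

Definition maximal_elements : set D := [set p | forall q, p <= q -> q = p].

End domain_theory.

Definition is_dcpo {d : Order.disp_t} (D : porderType d) :=
  forall I : set D, directed_set I -> exists s, isLub I s.

Definition is_domain {d : Order.disp_t} (D : porderType d) :=
  is_dcpo D /\
  forall p : D, directed_set (way_down p) /\ isLub (way_down p) p.

Definition omega_algebraic_dcpo {d : Order.disp_t} (D : porderType d) :=
  is_dcpo D /\
  exists B : set D,
    [/\ countable B, domain_basis B & forall p, B p -> compact_element p].

(* In an arbitrary poset the sets [way_up p] need not be a base of a topology,
   so they are declared as a subbase; on a domain they are a base of the
   resulting topology (lemma [way_up_basis] below). *)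
Definition scott {d : Order.disp_t} (D : porderType d) : Type := D.

HB.instance Definition _ {d : Order.disp_t} (D : porderType d) :=
  Choice.on (scott D).

HB.instance Definition _ {d : Order.disp_t} (D : porderType d) :=
  isSubBaseTopological.Build (scott D) (range (@way_up d D)) id.

Section scott_basis.
Context {d : Order.disp_t} {D : porderType d}.
Implicit Types p q r : D.

Lemma way_below_le q p : way_below q p -> q <= p.
Proof.
move=> /(_ [set p] p)[]//; last by move=> r ->.
- by split; [exists p | move=> a b -> ->; exists p].
- by split=> [a ->//|b]; exact.
Qed.

Lemma way_below_trans q q' p p' :
  q <= q' -> way_below q' p' -> p' <= p -> way_below q p.
Proof.
move=> qq' wb p'p I s dI lI ps.
have [r Ir q'r] := wb I s dI lI (le_trans p'p ps).
by exists r => //; exact: le_trans q'r.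
Qed.

Lemma omega_algebraic_is_domain : omega_algebraic_dcpo D -> is_domain D.
Proof.
move=> [dcpoD [B [_ basisB _]]]; split=> // p.
have [Bdir [_ Blub]] := basisB p; have [[q0 [_ q0p]] Bub] := Bdir.
split; last first.
  split=> [q /way_below_le//|b bub].
  by apply: Blub => q [_ /bub].
split; first by exists q0.
move=> q1 q2 /(_ _ _ Bdir (basisB p).2 (lexx p))[r1 Br1 q1r1].
move=> /(_ _ _ Bdir (basisB p).2 (lexx p))[r2 Br2 q2r2].
have [r [[_ rp] r1r r2r]] := Bub _ _ Br1 Br2.
by exists r; split=> //; [exact: le_trans r1r|exact: le_trans r2r].
Qed.

Lemma way_below_interpolation : is_domain D ->
  forall q p, way_below q p -> exists2 r, way_below q r & way_below r p.
Proof.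
move=> [_ domD] q p qp.
pose J := [set a : D | exists2 r, way_below a r & way_below r p].
have [[[r0 r0p] pdir] [_ plub]] := domD p.
have Jdir : directed_set J.
  split; first by have [[[a ar0] _] _] := domD r0; exists a, r0.
  move=> a1 a2 [r1 ar1 r1p] [r2 ar2 r2p].
  have [r [rp r1r r2r]] := pdir _ _ r1p r2p.
  have [[_ rdir] _] := domD r.
  have [a [ar a1a a2a]] := rdir a1 a2 (way_below_trans (lexx _) ar1 r1r)
    (way_below_trans (lexx _) ar2 r2r).
  by exists a; split=> //; exists r.
have Jlub : isLub J p.
  split=> [a [r /way_below_le ar /way_below_le rp]|b bub].
    exact: le_trans ar rp.
  apply: plub => r rp; apply: (domD r).2.2 => a ar.
  by apply: bub; exists r.
have [a [r ar rp] qa] := qp _ _ Jdir Jlub (lexx p).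
by exists r => //; exact: way_below_trans ar (lexx r).
Qed.

Lemma way_up_basis : is_domain D ->
  basis (range (@way_up d D) : set (set (scott D))).
Proof.
move=> domD; split=> [_ [p _ <-]|x A].
  exists [set (way_up p : set (scott D))]; last by rewrite bigcup_set1.
  move=> _ ->; exists [fset (way_up p : set (scott D))]%fset.
    by move=> U; rewrite in_fset1 => /eqP ->; apply/mem_set; exists p.
  by rewrite set_fset1 bigcap_set1.
rewrite nbhsE => -[_ [[E EfinI <-] [U EU Ux]] OA].
suff [q qx qU] : exists2 q, way_below q x & way_up q `<=` U.
  exists (way_up q); first by split=> //; exists q.
  by move=> y /qU Uy; apply: OA; exists U.
have [F FD FU] := EfinI _ EU; rewrite -FU in Ux *.
have [xne xdir] := (domD.2 x).1.
have filt : Filter (filter_from (way_down x) (@way_up d D)).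
  apply: filter_from_filter => // q1 q2 q1x q2x.
  have [q [qx q1q q2q]] := xdir q1 q2 q1x q2x.
  by exists q => // y qy; split; apply: way_below_trans qy (lexx _).
have [q qx qU] : filter_from (way_down x) (@way_up d D)
    (\bigcap_(V in [set` F]) V).
  apply: filter_bigI => V VF.
  have /set_mem[p _ pV] := FD _ VF; rewrite -pV.
  have /(way_below_interpolation domD)[q pq qx] : way_below p x.
    by have := Ux V VF; rewrite -pV.
  exists q => // y qy; apply: way_below_trans pq (way_below_le qy).
  exact: lexx.
by exists q.
Qed.

End scott_basis.

Definition homeomorphism {X Y : topologicalType} (f : X -> Y) :=
  continuous f /\
  exists g : Y -> X, [/\ cancel f g, cancel g f & continuous g].

Definition domain_representation (X : topologicalType) {d : Order.disp_t}
    (D : porderType d) :=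
  exists f : X -> set_type (maximal_elements : set (scott D)), homeomorphism f.

Section strong_Choquet_game.
Context {X : topologicalType}.

Definition moveI : Type := set X * X.

Definition round : Type := moveI * set X.

(* A finite history [h] lists the completed rounds in chronological order; for
   the empty history the constraint [U `<=` setT] is void. *)
Definition legalI (h : seq round) (m : moveI) :=
  [/\ open m.1, m.1 m.2 & m.1 `<=` last setT [seq r.2 | r <- h]].

Definition legalII (m : moveI) (V : set X) :=
  [/\ open V, V m.2 & V `<=` m.1].

Inductive legal_history : seq round -> Prop :=
| legal_history0 : legal_history [::]
| legal_historyS h m V : legal_history h -> legalI h m -> legalII m V ->
    legal_history (rcons h (m, V)).

Definition strategyII : Type := seq round -> moveI -> set X.

Definition legal_strategyII (s : strategyII) :=
  forall h m, legal_history h -> legalI h m -> legalII m (s h m).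

Definition winning_strategyII (s : strategyII) :=
  legal_strategyII s /\
  forall p : nat -> round,
    (forall i, legalI (mkseq p i) (p i).1) ->
    (forall i, (p i).2 = s (mkseq p i) (p i).1) ->
    \bigcap_i (p i).1.1 !=set0.

End strong_Choquet_game.

Definition strong_Choquet (X : topologicalType) :=
  exists s : @strategyII X, winning_strategyII s.

(* Main.v *)
(* From a representation, player II answers with cells of an increasing sequence
   of compact elements; any maximal element above its supremum is a point of
   the intersection.

   Conversely, fix a winning strategy. Second countability makes countably many
   positions consistent with it suffice. Take as conditions the finite nonempty
   sets of such positions whose open sets have a common point, preordered by
   continuing every position of the set into the intersection of its open sets,
   and take the ideal completion. Allowing finite sets of positions gives two
   conditions that hold at a point x a common extension that holds at x, so
   that the conditions holding at x form an ideal; the strategy shows that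
   every ideal is contained in one of these, and by T1 they are pairwise
   incomparable, hence they are exactly the maximal ideals. *)
From HB Require Import structures.
Require Import Defs.
From mathcomp Require Import all_boot all_order.
From mathcomp Require Import all_classical.
From mathcomp Require Import topology.

Set Implicit Arguments.
Unset Strict Implicit.
Unset Printing Implicit Defensive.

Import Order.TTheory.

Local Open Scope order_scope.
Local Open Scope classical_set_scope.

(** The default [t0] fills the indices that code no element of [A], and so covers an empty [A]
    too. *)
Lemma countable_enumeration (T : Type) (t0 : T) (A : set T) : countable A ->
  exists b : nat -> T, A `<=` range b /\ range b `<=` t0 |` A.
Proof.
case/countable_injP => e einj.
exists (fun n => if pselect (exists2 t, A t & e t = n) is left ex
                 then sval (cid2 ex) else t0); split=> [t At|_ [n _ <-]].
  exists (e t) => //; case: pselect => [ex|[]]; last by exists t.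
  by case: (cid2 ex) => u Au eut /=; apply: einj; rewrite ?inE.
by case: pselect => [ex|_]; [right; case: (cid2 ex)|left].
Qed.

Section maximal_elements.
Context {d : Order.disp_t} {D : porderType d}.

(** Zorn's lemma above [p]: a nonempty chain is directed, so it has a supremum, and the empty chain
    is bounded by [p]. *)
Lemma exists_maximal_above (p : D) :
  is_dcpo D -> exists2 m, maximal_elements m & p <= m.
Proof.
move=> dcpoD.
pose T := {q : D | p <= q}; pose R (s t : T) := val s <= val t.
have [|||A tA|[m pm] mP] := @Zorn T R.
- by move=> t; exact: lexx.
- by move=> r s t; exact: le_trans.
- by move=> s t st ts; apply/val_inj/le_anti/andP.
- have [[t0 At0]|A0] := pselect (A !=set0); last first.
    by exists (exist _ p (lexx p)) => s As; case: A0; exists s.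
  have dirA : directed_set (val @` A).
    split; first by exists (val t0), t0.
    move=> _ _ [s As <-] [t At <-]; case: (tA _ _ As At) => st.
      by exists (val t); split=> //; exists t.
    by exists (val s); split=> //; exists s.
  have [s [sub _]] := dcpoD _ dirA.
  have ps : p <= s by apply: le_trans (valP t0) (sub _ _); exists t0.
  by exists (exist _ s ps) => t At; apply: sub; exists t.
- exists m => // q mq.
  by have /(congr1 val) := mP (exist _ q (le_trans pm mq)) mq.
Qed.

End maximal_elements.

(** * From a representation to a countable base, T1 and a winning strategy *)

Section game_of_representation.
Context {X : topologicalType} {d : Order.disp_t} {D : porderType d}.
Context {B : set D}.
Hypotheses (dcpoD : is_dcpo D) (countableB : countable B).
Hypotheses (basisB : domain_basis B).
Hypothesis compactB : forall p, B p -> compact_element p.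
Context {f : X -> set_type (maximal_elements : set (scott D))}.
Hypothesis homeof : homeomorphism f.

Let phi (x : X) : D := \val (f x).
Let cell (b : D) : set X := [set x | way_below b (phi x)].

Let domD : is_domain D.
Proof. by apply: omega_algebraic_is_domain; split=> //; exists B. Qed.

Let phi_maximal x : maximal_elements (phi x).
Proof. exact: set_valP. Qed.

Let phi_surj m : maximal_elements m -> exists x, phi x = m.
Proof.
move=> mm; have [_ [g [_ gK _]]] := homeof.
by exists (g (exist _ m (mem_set mm))); rewrite /phi gK.
Qed.

Let open_cell b : open (cell b).
Proof.
have [cf _] := homeof.
have ob : open (way_up b : set (scott D)).
  by apply: (way_up_basis domD).1; exists b.
have /continuousP/(_ _ ob) := @initial_continuous _ _
  (set_val : maximal_elements -> scott D).
by move: cf => /continuousP /[apply].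
Qed.

Let cell_base (U : set X) x : open U -> U x ->
  exists b, [/\ B b, cell b x & cell b `<=` U].
Proof.
move=> oU Ux; have [_ [g [fK gK /continuousP/(_ _ oU) [W oW gW]]]] := homeof.
have gWE y : W (phi y) <-> U y.
  by have /(congr1 (fun S => S (f y))) := gW; rewrite /= fK /phi => ->.
have /((way_up_basis domD).2 (phi x : scott D)) [_ [[p _ <-] px] pW] :
    nbhs (phi x : scott D) W.
  by apply: open_nbhs_nbhs; split=> //; apply/gWE.
have [dirx lubx] := basisB (phi x).
have [b [Bb bx] pb] := px _ _ dirx lubx (lexx _).
exists b; split=> // y by_; apply/gWE/pW.
exact: way_below_trans pb by_ (lexx _).
Qed.

(** Directedness of the basis elements way below [phi x] merges one whose cell lies in [U] with one
    above [a]. *)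
Let cell_base_above (U : set X) x a : open U -> U x -> cell a x ->
  exists b, [/\ B b, cell b x, cell b `<=` U & a <= b].
Proof.
move=> oU Ux ax; have [b0 [Bb0 b0x b0U]] := cell_base oU Ux.
have [dirx lubx] := basisB (phi x).
have [b1 [Bb1 b1x] ab1] := ax _ _ dirx lubx (lexx _).
have [b [[Bb bx] b0b b1b]] := dirx.2 _ _ (conj Bb0 b0x) (conj Bb1 b1x).
exists b; split=> // [y by_|]; last exact: le_trans b1b.
exact/b0U/(way_below_trans b0b by_).
Qed.

Lemma second_countable_of_representation : @second_countable X.
Proof.
exists (cell @` B); first exact: sub_countable (card_image_le _ _) countableB.
split=> [_ [b _ <-]|x U]; first exact: open_cell.
rewrite nbhsE => -[V [oV Vx] VU]; have [b [Bb bx bV]] := cell_base oV Vx.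
by exists (cell b); [split=> //; exists b|exact: subset_trans VU].
Qed.

(** If no cell contains [x] and misses [y], then [phi x <= phi y], since [phi x] is the supremum of
    the basis elements way below it; maximality makes them equal. *)
Lemma accessible_of_representation : accessible_space X.
Proof.
move=> x y xy; suff [b [Bb bx bNy]] : exists b, [/\ B b, cell b x & ~ cell b y].
  by exists (cell b); split; [exact: open_cell|exact/mem_set|exact/mem_set].
apply: contrapT => noB; move/eqP: xy; apply.
have [_ [g [fK _ _]]] := homeof; apply: (can_inj fK); apply: val_inj => /=.
suff xy : phi x <= phi y by have := phi_maximal xy.
have [_ [_ lubx]] := basisB (phi x); apply: lubx => b [Bb bx].
by apply: way_below_le; apply: contrapT => bNy; apply: noB; exists b.
Qed.

Let good_response (A : set D) (m : @moveI X) : set D :=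
  [set b | [/\ B b, cell b m.2, cell b `<=` m.1 & forall a, A a -> a <= b]].

Let response A m : set D :=
  if pselect (good_response A m !=set0) is left ex then [set sval (cid ex)]
  else set0.

(* The basis elements chosen so far are recomputed from the history; the state
   is a set with at most one element, the last choice. *)
Let state (h : seq round) : set D :=
  foldl (fun A r => response A r.1) set0 h.

(** The default [m.1] keeps the answer legal where no good response exists; plays following the
    strategy never get there. *)
Let answer (h : seq round) (m : moveI) : set X :=
  if pselect (good_response (state h) m !=set0) is left ex
  then cell (sval (cid ex)) else m.1.

Let answer_legal : legal_strategyII answer.
Proof.
move=> h m _ [om mm _]; rewrite /answer; case: pselect => [ex|_]; last by split.
by case: (cid ex) => b [Bb bm bU _] /=; split=> //; exact: open_cell.
Qed.

Let stateS (p : nat -> round) n :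
  state (mkseq p n.+1) = response (state (mkseq p n)) (p n).1.
Proof. by rewrite /state mkseqS foldl_rcons. Qed.

Lemma strong_Choquet_of_representation : strong_Choquet X.
Proof.
exists answer; split; first exact: answer_legal.
move=> p pI pII.
pose chosen n b := [/\ state (mkseq p n.+1) = [set b], B b,
  cell b `<=` (p n).1.1, (p n).2 = cell b &
  forall a, state (mkseq p n) a -> a <= b].
have chosenP n : good_response (state (mkseq p n)) (p n).1 !=set0 ->
    exists b, chosen n b.
  (* [answer] and [response] choose from the same set with the same witness, so the cell played is
     that of the recorded element. *)
  move=> ex; have := pII n; rewrite /chosen stateS /answer /response.
  case: pselect => // ex'; case: (cid ex') => b [Bb bx bU ub] /= pE.
  by exists b; split.
have /choice[b bP] n : exists b, chosen n b.
  elim: n => [|n [a [aE Ba aU pE _]]]; apply: chosenP.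
    have [oU Ux _] := pI 0%N; have [b [Bb bx bU]] := cell_base oU Ux.
    by exists b; split.
  have [oU Ux UV] := pI n.+1.
  (* Legality puts the new point into the previous answer, which is [cell a]. *)
  have ax : cell a (p n.+1).1.2.
    by move/UV: Ux; rewrite mkseqS map_rcons last_rcons pE.
  have [b [Bb bx bU ab]] := cell_base_above oU Ux ax.
  by exists b; split=> // c; rewrite aE => ->.
have bS k : b k <= b k.+1.
  by have [bE _ _ _ _] := bP k; have [_ _ _ _] := bP k.+1; apply; rewrite bE.
have b_mono n k : b n <= b (k + n)%N.
  by elim: k => // k /le_trans; apply; rewrite addSn.
have [|s [ub _]] := dcpoD (I := range b).
  split; first by exists (b 0%N), 0%N.
  move=> _ _ [i _ <-] [j _ <-]; exists (b (i + j)%N); split=> //.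
  by rewrite addnC.
have [m mm sm] := exists_maximal_above s dcpoD.
have [x xm] := phi_surj mm; exists x => n _.
have [_ Bb bU _ _] := bP n; apply: bU; rewrite /cell /= xm.
(* Compactness turns [b n <= m] into the way-below relation. *)
apply: way_below_trans (compactB Bb) _; first exact: lexx.
by apply: le_trans sm; apply: ub; exists n.
Qed.

End game_of_representation.

(** * The ideal completion of a countable preorder *)

Section ideal_completion.
Context {P : countType} (R : P -> P -> Prop).

Definition is_ideal (I : set P) :=
  [/\ I !=set0, forall p q, I p -> I q -> exists r, [/\ I r, R p r & R q r] &
      forall p q, R p q -> I q -> I p].

Definition ideal_completion : Type := {I : set P | `[< is_ideal I >]}.

HB.instance Definition _ := Choice.on ideal_completion.

Definition ideal_le (I J : ideal_completion) := `[< val I `<=` val J >].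

Fact ideal_le_refl : reflexive ideal_le.
Proof. by move=> I; apply/asboolP. Qed.

Fact ideal_le_anti : antisymmetric ideal_le.
Proof.
by move=> I J /andP[/asboolP IJ /asboolP JI]; exact/val_inj/seteqP.
Qed.

Fact ideal_le_trans : transitive ideal_le.
Proof.
by move=> J I K /asboolP IJ /asboolP JK; apply/asboolP; exact: subset_trans JK.
Qed.

HB.instance Definition _ := Order.Le_isPOrder.Build (Order.Disp tt tt)
  ideal_completion ideal_le_refl ideal_le_anti ideal_le_trans.

Implicit Types (I J : ideal_completion) (S : set ideal_completion).

Lemma ideal_leP I J : (I <= J) <-> (val I `<=` val J).
Proof. by split=> /asboolP. Qed.

Lemma idealP I : is_ideal (val I).
Proof. exact/asboolP/(valP I). Qed.

Definition ideal_pack (I : set P) (HI : is_ideal I) : ideal_completion :=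
  exist _ I (asboolT HI).

Lemma directed_ideal_bigcup S : directed_set S ->
  is_ideal (\bigcup_(I in S) val I).
Proof.
move=> [[I0 SI0] dirS]; split.
- by have [[p I0p] _ _] := idealP I0; exists p, I0.
- move=> p q [I SI Ip] [J SJ Jq]; have [K [SK IK JK]] := dirS _ _ SI SJ.
  have [_ dirK _] := idealP K.
  have [r [Kr pr qr]] :=
    dirK _ _ ((ideal_leP _ _).1 IK _ Ip) ((ideal_leP _ _).1 JK _ Jq).
  by exists r; split=> //; exists K.
- move=> p q pq [I SI Iq]; have [_ _ downI] := idealP I.
  by exists I => //; exact: downI Iq.
Qed.

Lemma directed_ideal_isLub S (dS : directed_set S) :
  isLub S (ideal_pack (directed_ideal_bigcup dS)).
Proof.
split=> [I SI|J ubJ]; apply/ideal_leP; first exact: bigcup_sup.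
by apply: bigcup_sub => I SI; apply/ideal_leP/ubJ.
Qed.

Lemma directed_ideal_lub S I : directed_set S -> isLub S I ->
  val I = \bigcup_(J in S) val J.
Proof.
move=> dS [ubI lubI]; have [ubU lubU] := directed_ideal_isLub dS.
apply/seteqP; split; first exact: (ideal_leP _ _).1 (lubI _ ubU).
exact: (ideal_leP _ _).1 (lubU _ ubI).
Qed.

Lemma ideal_completion_dcpo : is_dcpo ideal_completion.
Proof.
move=> S dS; exists (ideal_pack (directed_ideal_bigcup dS)).
exact: directed_ideal_isLub.
Qed.

Hypothesis Rxx : forall p, R p p.
Hypothesis Rtrans : forall p q r, R p q -> R q r -> R p r.

Lemma principal_is_ideal p : is_ideal [set q | R q p].
Proof.
split; first by exists p; exact: Rxx.
  by move=> q r qp rp; exists p; split=> //; exact: Rxx.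
by move=> q r qr rp; exact: Rtrans rp.
Qed.

Definition principal p := ideal_pack (principal_is_ideal p).

Lemma principal_le p I : principal p <= I <-> val I p.
Proof.
split=> [/ideal_leP|Ip]; first by apply; exact: Rxx.
by apply/ideal_leP => q qp; have [_ _ downI] := idealP I; exact: downI Ip.
Qed.

(** Directed suprema of ideals are unions, so a generator in the supremum already lies in a member.
    Taking [I] to be [principal p] gives compactness. *)
Lemma way_below_principal p I : way_below (principal p) I <-> val I p.
Proof.
split=> [/way_below_le/principal_le//|Ip S s dS lubs /ideal_leP Is].
have := Is _ Ip; rewrite (directed_ideal_lub dS lubs) => -[J SJ Jp].
by exists J => //; apply/principal_le.
Qed.

Lemma principal_basis : domain_basis (range principal).
Proof.
move=> I; have [[p0 Ip0] dirI _] := idealP I; split; split.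
- by exists (principal p0); split; [exists p0|exact/way_below_principal].
- move=> _ _ [[p _ <-] /way_below_principal Ip]
    [[q _ <-] /way_below_principal Iq].
  have [r [Ir pr qr]] := dirI _ _ Ip Iq.
  exists (principal r); split; [|exact/principal_le|exact/principal_le].
  by split; [exists r|exact/way_below_principal].
- by move=> J [_ /way_below_le].
- move=> J ubJ; apply/ideal_leP => p Ip; apply/principal_le/ubJ.
  by split; [exists p|exact/way_below_principal].
Qed.

Lemma way_below_ideal I J :
  way_below I J -> exists2 p, val J p & I <= principal p.
Proof.
have [dirJ lubJ] := principal_basis J.
move=> /(_ _ _ dirJ lubJ (lexx _))[_ [[p _ <-] /way_below_principal Jp] Ip].
by exists p.
Qed.

Lemma ideal_completion_omega_algebraic : omega_algebraic_dcpo ideal_completion.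
Proof.
split; first exact: ideal_completion_dcpo.
exists (range principal); split; last 1 first.
- by move=> _ [p _ <-]; apply/way_below_principal; exact: Rxx.
- exact: sub_countable (card_image_le _ _) (countableP _).
- exact: principal_basis.
Qed.

End ideal_completion.

(** * Points of a T1 space as maximal ideals of cells *)

Section representation_by_ideals.
Context {X : topologicalType} {P : countType} {R : P -> P -> Prop}.
Hypothesis Rxx : forall p, R p p.
Hypothesis Rtrans : forall p q r, R p q -> R q r -> R p r.
Context {cell : P -> set X}.
Hypothesis accX : accessible_space X.
Hypothesis open_cell : forall p, open (cell p).
Hypothesis cell_sub : forall p q, R p q -> cell q `<=` cell p.
Hypothesis cell_meet : forall p q x, cell p x -> cell q x ->
  exists r, [/\ R p r, R q r & cell r x].
Hypothesis cell_base : forall U x, open U -> U x ->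
  exists2 p, cell p x & cell p `<=` U.
Hypothesis cell_ideal : forall I, is_ideal R I -> \bigcap_(p in I) cell p !=set0.

Let point_is_ideal x : is_ideal R [set p | cell p x].
Proof.
split.
- by have [p px _] := @cell_base setT x openT I; exists p.
- by move=> p q px qx; have [r [pr qr rx]] := cell_meet px qx; exists r.
- by move=> p q pq; exact: cell_sub.
Qed.

Let point_ideal x : ideal_completion R := ideal_pack (point_is_ideal x).

Let point_ideal_le x y : point_ideal x <= point_ideal y -> x = y.
Proof.
move=> /ideal_leP xy; apply/eqP; apply: contraPT isT => /accX[U [oU xU yU]] _.
have [p px pU] := cell_base oU (set_mem xU).
by case: (set_mem yU); exact/pU/xy.
Qed.

Let below_point (J : ideal_completion R) : exists x, J <= point_ideal x.
Proof.
have [x xJ] := cell_ideal (idealP J); exists x; apply/ideal_leP => p Jp.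
exact: xJ.
Qed.

(** An ideal above that of [x] lies below that of some [y]; T1 forces [x = y], and the three ideals
    coincide. *)
Let point_ideal_maximal x : maximal_elements (point_ideal x).
Proof.
move=> J xJ; have [y Jy] := below_point J.
have xy := point_ideal_le (le_trans xJ Jy).
by apply/le_anti; rewrite xJ xy Jy.
Qed.

Let maximal_is_point (J : ideal_completion R) :
  maximal_elements J -> exists x, point_ideal x = J.
Proof. by move=> mJ; have [x /mJ] := below_point J; exists x. Qed.

Lemma representation_by_ideals : domain_representation X (ideal_completion R).
Proof.
have domD := omega_algebraic_is_domain
  (ideal_completion_omega_algebraic Rxx Rtrans).
pose M := maximal_elements : set (scott (ideal_completion R)).
pose f x : M := exist _ (point_ideal x) (mem_set (@point_ideal_maximal x)).
have gP (J : M) : exists x, point_ideal x = \val J.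
  exact: maximal_is_point (set_valP J).
pose g (J : M) : X := sval (cid (gP J)).
have gE J : point_ideal (g J) = \val J by exact: svalP (cid (gP J)).
exists f; split.
  apply/continuousP => _ [W oW <-]; rewrite openE => x /= Wx.
  have /((way_up_basis domD).2 (point_ideal x : scott _)) [_ [[I _ <-] Ix] IW] :
      nbhs (point_ideal x : scott (ideal_completion R)) W.
    exact: open_nbhs_nbhs.
  have [p px Ip] := way_below_ideal Rxx Rtrans Ix.
  rewrite /interior nbhsE; exists (cell p); first by split.
  move=> y py; apply: IW; apply: way_below_trans Ip _ (lexx _).
  exact/way_below_principal.
exists g; split.
- by move=> x; apply: point_ideal_le; rewrite gE.
- by move=> J; apply: val_inj; rewrite /= gE.
(* A point lies in [U] exactly when its ideal contains some [p] in [Q], that is, when [principal p]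
   is way below it. *)
apply/continuousP => U oU; pose Q := [set p | cell p `<=` U].
exists (\bigcup_(p in Q) way_up (principal Rxx Rtrans p : scott _)).
  apply: bigcup_open => p _.
  by apply: (way_up_basis domD).1; exists (principal Rxx Rtrans p).
apply/seteqP; split=> J /=; rewrite /preimage /= set_valE -gE.
  by move=> [p pU /way_below_principal]; exact: pU.
by move=> /(cell_base oU)[p px pU]; exists p => //; exact/way_below_principal.
Qed.

End representation_by_ideals.

(** * From a winning strategy to a countable preorder of conditions *)

Section representation_of_game.
Context {X : topologicalType} {s : @strategyII X}.
Hypothesis winning_s : winning_strategyII s.
Context {b : nat -> set X}.
Hypothesis open_b : forall n, open (b n).
Hypothesis base_b : forall U x, open U -> U x -> exists2 n, b n x & b n `<=` U.

Let region (h : seq (@round X)) : set X := last setT [seq r.2 | r <- h].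

Inductive follows : seq (@round X) -> Prop :=
| follows0 : follows [::]
| followsS h m : follows h -> legalI h m -> follows (rcons h (m, s h m)).

Let region_rcons h r : region (rcons h r) = r.2.
Proof. by rewrite /region map_rcons last_rcons. Qed.

Let follows_legal h : follows h -> legal_history h.
Proof.
elim=> [|{}h m _ legal_h legal_m]; first exact: legal_history0.
by apply: legal_historyS => //; exact: winning_s.1.
Qed.

Let follows_open h : follows h -> open (region h).
Proof.
elim=> [|{}h m fh _ legal_m]; first exact: openT.
by rewrite region_rcons; have [] := winning_s.1 _ _ (follows_legal fh) legal_m.
Qed.

Let follows_nth r0 h i : follows h -> (i < size h)%N ->
  legalI (take i h) (nth r0 h i).1 /\
  (nth r0 h i).2 = s (take i h) (nth r0 h i).1.
Proof.
elim=> // {}h m fh IH legal_m; rewrite size_rcons ltnS leq_eqVlt nth_rcons.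
rewrite -cats1; case: ltngtP => //= [ih _|-> _].
  by rewrite takel_cat 1?ltnW //; exact: IH.
by rewrite take_size_cat.
Qed.

(** The added part [r :: t] is nonempty, so a chain of extensions determines an infinite play. *)
Let extends (h h' : seq (@round X)) := exists r t, h' = h ++ r :: t.

Let extends_trans h1 h2 h3 : extends h1 h2 -> extends h2 h3 -> extends h1 h3.
Proof.
by move=> [r [t ->]] [r' [t' ->]]; exists r, (t ++ r' :: t'); rewrite -catA.
Qed.

(** The histories are prefixes of one infinite play following [s], which player II wins. *)
Let follows_chain (h : nat -> seq (@round X)) :
  (forall n, follows (h n)) -> (forall n, extends (h n) (h n.+1)) ->
  exists x, forall n, region (h n) x.
Proof.
move=> fh eh; have [r0 _] := eh 0%N.
have size_h n : (n <= size (h n))%N.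
  elim: n => // n IH; have [r [t ->]] := eh n.
  by rewrite size_cat /= addnS ltnS (leq_trans IH) ?leq_addr.
have nth_h n k j : (j < size (h n))%N -> nth r0 (h (k + n)%N) j = nth r0 (h n) j.
  move=> jn; elim: k => // k <-; have [r [t ->]] := eh (k + n)%N.
  rewrite nth_cat ifT // (leq_trans jn) // {jn}; elim: k => // k IH.
  have [r1 [t1 ->]] := eh (k + n)%N.
  by rewrite (leq_trans IH) // size_cat leq_addr.
(* By [size_h], [h i.+1] has more than [i] rounds, so the default [r0] is never read. *)
pose p i := nth r0 (h i.+1) i.
have pE n : mkseq p (size (h n)) = h n.
  apply: (@eq_from_nth _ r0); rewrite size_mkseq // => i ih.
  by rewrite nth_mkseq // /p -(nth_h n i.+1) // addnC nth_h.
have takeE i : take i (h i.+1) = mkseq p i.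
  rewrite -[h i.+1]pE /mkseq -map_take take_iota; congr (map _ (iota _ _)).
  exact/minn_idPl/ltnW.
have pP i := follows_nth r0 (fh i.+1) (size_h i.+1).
have [|i|x xp] := winning_s.2 p.
- by move=> i; have [] := pP i; rewrite takeE.
- by have [] := pP i; rewrite takeE.
(* The move that follows [h n] in the play is an open set inside [region (h n)], and it contains
   [x]. *)
exists x => n; have [legal_n _] := pP (size (h n)).
rewrite takeE pE in legal_n; have [_ _] := legal_n; apply.
exact: xp.
Qed.

(* A code [(n, k)] stands for the move in which player I plays [b n] together
   with some point whose answer contains [b k]; thus countably many points are
   enough for the answers to cover [b n]. A code without such a point leaves
   the history unchanged. *)
Let code : Type := seq (nat * nat).

Let decode_step h (nk : nat * nat) : seq (@round X) :=
  if pselect (exists y, legalI h (b nk.1, y) /\ b nk.2 `<=` s h (b nk.1, y))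
    is left ex
  then let m := (b nk.1, sval (cid ex)) in rcons h (m, s h m) else h.

Let decode (c : code) := foldl decode_step [::] c.

Let decode_follows c : follows (decode c).
Proof.
elim/last_ind: c => [|c nk IH]; first exact: follows0.
rewrite /decode foldl_rcons -/(decode c) /decode_step.
case: pselect => // ex; case: (cid ex) => y [legal_y _] /=.
exact: followsS.
Qed.

Let cell (c : code) := region (decode c).

Let refines (p : seq code) U (q : seq code) :=
  forall c, c \in p -> exists2 c', c' \in q &
    extends (decode c) (decode c') /\ cell c' `<=` U.

Let inter (p : seq code) : set X := [set x | forall c, c \in p -> cell c x].

(** Play [x] in a basic set inside [U] and [cell c], and record a basic neighbourhood [b k] of [x]
    inside the answer. Decoding may pick another point [y], but the answer to [y] still contains
    [b k], hence [x]. *)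
Let decode_extend c U x : open U -> U x -> cell c x ->
  exists c', [/\ extends (decode c) (decode c'), cell c' x & cell c' `<=` U].
Proof.
move=> oU Ux cx; have fc := decode_follows c.
have [n nx nU] : exists2 n, b n x & b n `<=` U `&` cell c.
  by apply: base_b; [exact: openI oU (follows_open fc)|].
have legal_x : legalI (decode c) (b n, x) by split=> [|//|y /nU[]//]; exact: open_b.
have [oV Vx _] := winning_s.1 _ _ (follows_legal fc) legal_x.
have [k kx kV] := base_b oV Vx.
exists (rcons c (n, k)); rewrite /cell /decode foldl_rcons -/(decode c).
rewrite /decode_step; case: pselect => [ex|[]]; last by exists x.
case: (cid ex) => y [legal_y ky] /=; rewrite region_rcons /=; split.
- by rewrite /extends -cats1; eexists; exists [::].
- exact: ky.
- have [_ _ sub] := winning_s.1 _ _ (follows_legal fc) legal_y.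
  by move=> z /sub/nU[].
Qed.

Let open_inter p : open (inter p).
Proof.
elim: p => [|c p IH].
  have -> : inter [::] = setT by apply/seteqP; split.
  exact: openT.
suff -> : inter (c :: p) = cell c `&` inter p.
  exact: openI (follows_open (decode_follows c)) IH.
apply/seteqP; split=> x => [cpx|[cx px] c'].
  by split=> [|c' c'p]; apply: cpx; rewrite inE ?eqxx ?c'p ?orbT.
by rewrite inE => /orP[/eqP ->|/px].
Qed.

(** Each position is continued separately around [x]; the size equation serves to show that the new
    set is nonempty. *)
Let exists_refinement p U x : open U -> U x -> inter p x ->
  exists2 q, size q = size p & refines p U q /\ inter q x.
Proof.
move=> oU Ux px.
have /choice[F FP] c : exists c', c \in p ->
    [/\ extends (decode c) (decode c'), cell c' x & cell c' `<=` U].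
  have [cp|_] := boolP (c \in p); last by exists c.
  by have [c' c'P] := decode_extend oU Ux (px _ cp); exists c'.
exists (map F p); first by rewrite size_map.
split=> [c cp|c' /mapP[c cp ->]]; last by have [] := FP _ cp.
by exists (F c); [exact: map_f|have [] := FP _ cp].
Qed.

Let condition := {p : seq code | (p != [::]) && `[< inter p !=set0 >]}.

(* Every position of [p], not merely one, must be continued inside the whole
   region of [p]: any descending sequence of conditions then contains a single
   infinite play whose regions are cofinal with those of the sequence. *)
Let deeper (p q : condition) := refines (val p) (inter (val p)) (val q).

Let extension (p q : condition) := p = q \/ deeper p q.

Let condition_nonempty (p : condition) : exists c, c \in val p.
Proof.
case: p => -[|c p] //= _; exists c; exact: mem_head.
Qed.

Let pack p x : p != [::] -> inter p x -> exists q : condition, val q = p.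
Proof.
move=> p0 px; have pP : (p != [::]) && `[< inter p !=set0 >].
  by rewrite p0; apply/asboolP; exists x.
by exists (exist _ p pP).
Qed.

Let deeper_sub p q : deeper p q -> inter (val q) `<=` inter (val p).
Proof.
move=> pq; have [c cp] := condition_nonempty p.
by have [c' c'q [_ c'p]] := pq c cp => x /(_ _ c'q)/c'p.
Qed.

Let deeper_trans p q r : deeper p q -> deeper q r -> deeper p r.
Proof.
move=> pq qr c cp; have [c' c'q [cc' c'p]] := pq c cp.
have [c'' c''r [c'c'' c''q]] := qr c' c'q.
exists c'' => //; split; first exact: extends_trans c'c''.
by move=> x /c''q/(_ _ c'q)/c'p.
Qed.

Let extension_sub p q : extension p q -> inter (val q) `<=` inter (val p).
Proof. by case=> [->//|]; exact: deeper_sub. Qed.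

Let extension_deeper p q r : extension p q -> deeper q r -> deeper p r.
Proof. by case=> [->//|]; exact: deeper_trans. Qed.

(** Refine the concatenation of both lists into the intersection of both regions: the result is
    deeper than each. *)
Let common_extension p q x : inter (val p) x -> inter (val q) x ->
  exists r, [/\ extension p r, extension q r & inter (val r) x].
Proof.
move=> px qx.
have [|r sr [pqr rx]] := @exists_refinement (val p ++ val q)
  (inter (val p) `&` inter (val q)) x (openI (open_inter _) (open_inter _))
  (conj px qx).
  by move=> c; rewrite mem_cat => /orP[/px|/qx].
have [|r' r'E] := @pack r x _ rx.
  rewrite -size_eq0 sr size_cat addn_eq0 size_eq0.
  by have /andP[/negbTE -> _] := valP p.
exists r'; rewrite r'E; split=> //; right; rewrite /deeper r'E => c cp.
  have [|c' c'r [cc' sub]] := pqr c; first by rewrite mem_cat cp.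
  by exists c' => //; split=> // y /sub[].
have [|c' c'r [cc' sub]] := pqr c; first by rewrite mem_cat cp orbT.
by exists c' => //; split=> // y /sub[].
Qed.

Let condition_base U x : open U -> U x ->
  exists2 p : condition, inter (val p) x & inter (val p) `<=` U.
Proof.
(* The empty code decodes to the empty history, whose region is the whole space. *)
move=> oU Ux; have [c [_ cx cU]] := @decode_extend [::] U x oU Ux I.
have px : inter [:: c] x by move=> c'; rewrite inE => /eqP ->.
have [//|p pE] := @pack [:: c] x _ px.
by exists p; rewrite pE // => y /(_ c (mem_head _ _))/cU.
Qed.

Let ideal_meets (J : set condition) : is_ideal extension J ->
  \bigcap_(p in J) inter (val p) !=set0.
Proof.
move=> [[p0 Jp0] dirJ _].
(* If nothing in [J] is deeper than [p], every common extension of [p] in [J] is [p] itself, so any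
   point of its region works. *)
have [[p Jp pmin]|nomin] :=
    pselect (exists2 p, J p & forall q, J q -> ~ deeper p q).
  have /andP[_ /asboolP[x px]] := valP p; exists x => q Jq.
  have [r [Jr pr qr]] := dirJ _ _ Jp Jq.
  by case: pr qr => [<- /extension_sub|/(pmin _ Jr)//]; apply.
have deeperJ p : J p -> exists2 q, J q & deeper p q.
  move=> Jp; apply: contrapT => noq; apply: nomin; exists p => // q Jq pq.
  by apply: noq; exists q.
(* Otherwise a sequence in [J] is built together with one position of each condition; stage [n]
   takes care of the condition coded by [n]. *)
pose next n (v w : condition * code) := [/\ J w.1, w.2 \in val w.1,
  extends (decode v.2) (decode w.2), cell w.2 `<=` inter (val v.1) &
  forall q, unpickle n = Some q -> J q -> extension q w.1].
have nextP n v : exists w, J v.1 -> v.2 \in val v.1 -> next n v w.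
  have [[Jv vv]|nv] := pselect (J v.1 /\ v.2 \in val v.1); last first.
    by exists v => Jv vv; case: nv.
  have [r [Jr vr qr]] : exists r, [/\ J r, extension v.1 r &
      forall q, unpickle n = Some q -> J q -> extension q r].
    case: (unpickle n) => [q|]; last by exists v.1; split=> //; left.
    have [Jq|nJq] := pselect (J q); last first.
      by exists v.1; split=> // [|_ [<-]//]; left.
    have [r [Jr vr qr]] := dirJ _ _ Jv Jq.
    by exists r; split=> // _ [<-].
  (* Passing from [r] to a deeper [t] ensures that the position gains a round even if [r] equals
     [v.1]. *)
  have [t Jt rt] := deeperJ r Jr.
  have [c ct [vc cv]] := extension_deeper vr rt vv.
  exists (t, c) => _ _; split=> // q qn Jq; right.
  exact: extension_deeper (qr q qn Jq) rt.
have [F FP] := choice (fun nv => nextP nv.1 nv.2).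
have [c0 c0p0] := condition_nonempty p0.
pose e := fix e n := if n is n'.+1 then F (n', e n') else (p0, c0).
have eP n : J (e n).1 /\ (e n).2 \in val (e n).1.
  by elim: n => [//|n [Je ee]] /=; have [] := FP (n, e n) Je ee.
have eS n : next n (e n) (e n.+1).
  by have [Je ee] := eP n; exact: FP (n, e n) Je ee.
have [|n|x xe] := @follows_chain (fun n => decode (e n).2).
- by move=> n; exact: decode_follows.
- by have [] := eS n.
exists x => q Jq; have [_ _ _ _ qe] := eS (pickle q).
apply: extension_sub (qe q (pickleK q) Jq) _ _.
(* The condition extending [q] appears at index [(pickle q).+1]; only the position one index later
   is known to lie in its whole region. *)
by have [_ _ _ sub _] := eS (pickle q).+1; exact/sub/xe.
Qed.

Lemma representation_of_game : accessible_space X ->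
  exists (d : Order.disp_t) (D : porderType d),
    omega_algebraic_dcpo D /\ domain_representation X D.
Proof.
move=> accX.
have Rxx p : extension p p by left.
have Rtrans p q r : extension p q -> extension q r -> extension p r.
  by move=> pq [<-//|qr]; right; exact: extension_deeper qr.
exists (Order.Disp tt tt), (ideal_completion extension); split.
  exact: ideal_completion_omega_algebraic.
exact: (@representation_by_ideals X condition extension Rxx Rtrans
  (fun p => inter (val p))).
Qed.

End representation_of_game.

Theorem theorem6p1 (X : topologicalType) :
  (exists (d : Order.disp_t) (D : porderType d),
      omega_algebraic_dcpo D /\ domain_representation X D) <->
  [/\ @second_countable X, accessible_space X & strong_Choquet X].
Proof.
split=> [[d [D [[dcpoD [B [cB basisB compB]]] [f homeof]]]]|].
  split.
  - exact: (second_countable_of_representation dcpoD cB basisB compB homeof).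
  - exact: (accessible_of_representation dcpoD cB basisB compB homeof).
  - exact: (strong_Choquet_of_representation dcpoD cB basisB compB homeof).
move=> [[B cB [oB baseB]] accX [s winning_s]].
have [b [Bb bB]] := countable_enumeration set0 cB.
apply: (@representation_of_game X s winning_s b) => // [n|U x oU Ux].
  (* The default value of the enumeration is the empty set, which is open. *)
  by have [->|/oB//] : (set0 |` B) (b n) by [apply: bB; exists n]; exact: open0.
have /baseB[V [BV Vx] VU] : nbhs x U by exact: open_nbhs_nbhs.
by have [n _ nV] := Bb _ BV; exists n; rewrite nV.
Qed.
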